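(* Let $K$ be a field with algebraic closure $\overline{K}$, let $f_1,f_2\in K[x]$ be nonconstant, and let $d\ge 1$ be an integer. Suppose $c_1,\dots,c_{2d}\in\overline{K}$ satisfy $f_1(c_i)=f_1(c_{i+1})$ for odd $i$ and $f_2(c_i)=f_2(c_{i+1})$ for even $i$ (where $1\le i\le 2d$ and $c_{2d+1}:=c_1$). If $f_1$ and $f_2$ have a common composite, then $$1=\prod_{i=1}^d\frac{m_1(c_{2i-1})}{m_2(c_{2i-1})}\cdot\frac{m_2(c_{2i})}{m_1(c_{2i})}.$$
   Context: Nonconstant polynomials $f_1,f_2\in K[x]$ have a common composite (over $K$) if there are nonconstant $u,v\in K[x]$ such that $u(f_1(x))=v(f_2(x))$. For $a\in\overline{K}$ and $i\in\{1,2\}$, $m_i(a)$ is the multiplicity of $x=a$ as a root of $f_i(x)-f_i(a)$ (equivalently, the ramification index of $x=a$ in $\overline{K}(x)/\overline{K}(f_i(x))$). *)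

(* Defs.v *)
From mathcomp Require Import all_boot all_order all_algebra.

Set Implicit Arguments.
Unset Strict Implicit.
Unset Printing Implicit Defensive.

Import GRing.Theory.

Local Open Scope ring_scope.

Definition nonconstant (R : nzRingType) (p : {poly R}) : bool :=
  (1 < size p)%N.

(* [iota : K -> L] presents [L] as an algebraic closure of [K]; that [L] is
   algebraically closed is part of its type. *)
Definition is_algebraic_closure (K : fieldType) (L : closedFieldType)
    (iota : {rmorphism K -> L}) : Prop :=
  forall z : L, algebraicOver iota z.

Definition has_common_composite (K : fieldType) (f1 f2 : {poly K}) : Prop :=
  exists u v : {poly K},
    [/\ nonconstant u, nonconstant v & u \Po f1 = v \Po f2].

Definition ram_mult (L : fieldType) (f : {poly L}) (a : L) : nat :=
  mup a (f - f.[a]%:P).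

(* Main.v *)
Require Import Defs.
From mathcomp Require Import all_boot all_order all_algebra.
From mathcomp Require Import zify.

Import GRing.Theory Num.Theory.

Local Open Scope ring_scope.

(** Ramification indices multiply in the tower given by a composite. If
    [u \Po f1 = v \Po f2], and [e_u], [e_v] are the ramification indices of [u]
    and [v], then computing the ramification index of this common polynomial at
    [a] in both ways ([ram_mult_comp]) gives
      [e_u (f1 a) * m1 a = e_v (f2 a) * m2 a],
    so [m1 a / m2 a = e_v (f2 a) / e_u (f1 a)] ([ram_mult_ratio]): a function
    of [f2 a] divided by a function of [f1 a]. In the quotient of two such
    ratios taken at points with the same image under [f1], the denominators
    cancel, so the [i]-th factor of the product is
      [e_v (f2 (c (2 i - 1))) / e_v (f2 (c (2 i)))].
    As [f2] agrees on [c (2 i)] and [c (2 i + 1)], the product telescopes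
    around the closed path and equals 1. *)

(** The value of [mup] at the zero polynomial is the one for which the
    multiplicativity statements below also cover constant polynomials. *)
Lemma mup0 (F : fieldType) (a : F) : mup a 0 = 0%N.
Proof.
(* [mup] is a maximum over exponents bounded by the size of the polynomial. *)
rewrite /mup; case: arg_maxnP => [|[i i_lt] _ _ /=]; first by rewrite dvdp0.
by move: i_lt; rewrite size_poly0; case: i.
Qed.

Lemma mup_exp (F : fieldType) (a : F) (p : {poly F}) (n : nat) :
  mup a (p ^+ n) = (n * mup a p)%N.
Proof.
elim: n => [|n IHn]; first by rewrite expr0 mupNroot // root1.
have [->|p_nz] := eqVneq p 0; first by rewrite exprS mul0r mup0 muln0.
by rewrite exprS mupM ?expf_neq0 // IHn mulSn.
Qed.

Lemma ram_mult_gt0 (F : fieldType) (f : {poly F}) (a : F) :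
  nonconstant f -> (0 < ram_mult f a)%N.
Proof.
move=> nc_f; have nz : f - f.[a]%:P != 0.
  apply: contraTneq nc_f => /subr0_eq ->.
  by rewrite /nonconstant -leqNgt size_polyC_leq1.
by rewrite -XsubC_dvd // dvdp_XsubCl rootE !hornerE subrr.
Qed.

(** Writing [u - u(b) = q (X - b)^e] with [b = f(a)] and [q(b) != 0],
    substitution of [f] gives [q(f) (f - f(a))^e], whose first factor does not
    vanish at [a]. *)
Lemma ram_mult_comp (F : fieldType) (u f : {poly F}) (a : F) :
  ram_mult (u \Po f) a = (ram_mult u f.[a] * ram_mult f a)%N.
Proof.
rewrite /ram_mult horner_comp; set b := f.[a].
have -> : u \Po f - u.[b]%:P = (u - u.[b]%:P) \Po f.
  by rewrite rmorphB /= comp_polyC.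
have [->|u_nz] := eqVneq (u - u.[b]%:P) 0; first by rewrite comp_poly0 !mup0.
have [e [q]] := multiplicity_XsubC (u - u.[b]%:P) b.
rewrite u_nz /= => qNb ->.
have qfNa : ~~ root (q \Po f) a by rewrite rootE horner_comp -rootE.
rewrite (mupMr _ qNb) mup_XsubCX eqxx rmorphM rmorphXn /= (mupMr _ qfNa).
by rewrite rmorphB /= comp_polyX comp_polyC mup_exp.
Qed.

Lemma ram_mult_ratio (F : fieldType) (f1 f2 u v : {poly F}) (a : F) :
    nonconstant f2 -> nonconstant u -> u \Po f1 = v \Po f2 ->
  (ram_mult f1 a)%:R / (ram_mult f2 a)%:R
    = (ram_mult v f2.[a])%:R / (ram_mult u f1.[a])%:R :> rat.
Proof.
move=> nc_f2 nc_u uf1_vf2; apply/eqP.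
rewrite eqr_div ?pnatr_eq0 -?lt0n ?ram_mult_gt0 // -!natrM.
by rewrite mulnC -!ram_mult_comp uf1_vf2.
Qed.

Theorem theorem8p3 (K : fieldType) (Kbar : closedFieldType)
    (iota : {rmorphism K -> Kbar}) (closK : is_algebraic_closure iota)
    (f1 f2 : {poly K}) (nc_f1 : nonconstant f1) (nc_f2 : nonconstant f2)
    (d : nat) (d_ge1 : (1 <= d)%N)
    (c : nat -> Kbar) (c_cyclic : c (2 * d + 1)%N = c 1%N)
    (c_odd : forall i : nat, (1 <= i <= 2 * d)%N -> odd i ->
       (map_poly iota f1).[c i] = (map_poly iota f1).[c (i + 1)%N])
    (c_even : forall i : nat, (1 <= i <= 2 * d)%N -> ~~ odd i ->
       (map_poly iota f2).[c i] = (map_poly iota f2).[c (i + 1)%N])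
    (ccf : has_common_composite f1 f2) :
  let m1 (a : Kbar) : rat := (ram_mult (map_poly iota f1) a)%:R in
  let m2 (a : Kbar) : rat := (ram_mult (map_poly iota f2) a)%:R in
  1 = \prod_(1 <= i < d.+1)
        (m1 (c (2 * i - 1)%N) / m2 (c (2 * i - 1)%N)
         * (m2 (c (2 * i)%N) / m1 (c (2 * i)%N))).
Proof.
move=> m1 m2; case: ccf => u [v [nc_u nc_v uf1_vf2]].
have nc_map p : nonconstant p -> nonconstant (map_poly iota p).
  by rewrite /nonconstant size_map_poly.
have comp_eq : map_poly iota u \Po map_poly iota f1
             = map_poly iota v \Po map_poly iota f2.
  by rewrite -!map_comp_poly uf1_vf2.
pose eu b : rat := (ram_mult (map_poly iota u) b)%:R.
pose ev b : rat := (ram_mult (map_poly iota v) b)%:R.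
have eu_nz b : eu b != 0 by rewrite pnatr_eq0 -lt0n ram_mult_gt0 ?nc_map.
have ev_nz b : ev b != 0 by rewrite pnatr_eq0 -lt0n ram_mult_gt0 ?nc_map.
have ratio a : m1 a / m2 a
    = ev (map_poly iota f2).[a] / eu (map_poly iota f1).[a].
  by apply: ram_mult_ratio; rewrite ?nc_map.
pose g i := ev (map_poly iota f2).[c (2 * i - 1)%N].
rewrite (telescope_prodr_eq g) // => [|i _|i /andP[i_ge1 i_le]].
- have -> : g d.+1 = g 1%N.
    by rewrite /g (_ : 2 * d.+1 - 1 = 2 * d + 1)%N ?c_cyclic //; lia.
  by rewrite divff ?ev_nz.
- by rewrite unitfE ev_nz.
rewrite -[m2 _ / _]invf_div !ratio invf_div.
have f1_eq : (map_poly iota f1).[c (2 * i - 1)%N]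
           = (map_poly iota f1).[c (2 * i)%N].
  by rewrite c_odd ?subnK //; lia.
have f2_eq : (map_poly iota f2).[c (2 * i)%N]
           = (map_poly iota f2).[c (2 * i.+1 - 1)%N].
  by rewrite c_even; [congr (_.[c _]) | |]; lia.
by rewrite f1_eq f2_eq mulrA divfK.
Qed.
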